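(* Let $0 \leq p \leq 1$ and $n \geq 10$. For a set $S$ of $n$ points in the real plane, not all on a line, color each point independently blue with probability $p$ and red with probability $1-p$. Then, among all such non-collinear sets of $n$ points, the expected number of monochromatic lines is uniquely minimized by the near-pencil on $n$ points; that is, every non-collinear $n$-point set that is not a near-pencil has strictly larger expected number of monochromatic lines than a near-pencil on $n$ points.
   Context: A line is determined by $S$ if it contains at least two points of $S$; such a line is monochromatic if all points of $S$ on it have the same color. A near-pencil on $n$ points is a set of $n$ points of which exactly $n-1$ lie on a common line. *)

(* Defs.v *)
From HB Require Import structures.
From mathcomp Require Export all_boot all_order all_algebra finmap.
From mathcomp Require Export boolp classical_sets cardinality reals.
From mathcomp Require Import ring.

Set Implicit Arguments.
Unset Strict Implicit.
Unset Printing Implicit Defensive.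

Export Order.TTheory GRing.Theory Num.Theory.

Local Open Scope classical_set_scope.
Local Open Scope ring_scope.

Definition is_line (R : realType) (L : set (R * R)) : Prop :=
  exists a b c : R,
    (a, b) <> (0, 0) /\ L = [set z | a * z.1 + b * z.2 = c].

Definition collinear (R : realType) (S : {fset R * R}) : Prop :=
  exists L : set (R * R), is_line L /\ [set` S] `<=` L.

Definition determined_line (R : realType) (S : {fset R * R})
    (L : set (R * R)) : Prop :=
  is_line L /\
  exists x y : R * R, [/\ x \in S, y \in S, x <> y, L x & L y].

Definition near_pencil (R : realType) (S : {fset R * R}) : Prop :=
  exists L : set (R * R),
    is_line L /\ #|` [fset x in S | x \in L]%fset | = (#|` S| - 1)%N.

(* [true] is blue, [false] is red. *)
Definition coloring (R : realType) (S : {fset R * R}) := {ffun S -> bool}.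

Definition monochromatic_lines (R : realType) (S : {fset R * R})
    (c : coloring S) : set (set (R * R)) :=
  [set L | determined_line S L /\
    forall x y : S, L (val x) -> L (val y) -> c x = c y].

Lemma finite_determined_lines (R : realType) (S : {fset R * R}) :
  finite_set (determined_line S).
Proof.
pose F (x y : R * R) : set (R * R) :=
  [set z | (y.2 - x.2) * (z.1 - x.1) = (y.1 - x.1) * (z.2 - x.2)].
have finF : finite_set [set F x y | x in [set` S] & y in [set` S]].
  by apply: finite_image2; exact: finite_fset.
apply: (sub_finite_set _ finF) => L [[a [b [d [ab ->]]]] [x [y []]]] /= xS yS xy.
move=> Lx Ly; exists x => //; exists y => //; rewrite /F.
move: x y xy Lx Ly {xS yS} => [x1 x2] [y1 y2] /= xy Lx Ly.
have k0 : a * (y1 - x1) + b * (y2 - x2) = 0.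
  by rewrite -(subrr d) -{1}Ly -Lx; ring.
apply/esym/seteqP; split => -[z1 z2] /= h.
- have h0 : a * (z1 - x1) + b * (z2 - x2) = 0.
    by rewrite -(subrr d) -{1}h -Lx; ring.
  apply/eqP; rewrite -subr_eq0; apply/eqP; set D := (X in X = 0).
  have aD : a * D = 0.
    have -> : a * D = (y2 - x2) * (a * (z1 - x1) + b * (z2 - x2))
                - (z2 - x2) * (a * (y1 - x1) + b * (y2 - x2)) by rewrite /D; ring.
    by rewrite h0 k0 !mulr0 subrr.
  have bD : b * D = 0.
    have -> : b * D = (z1 - x1) * (a * (y1 - x1) + b * (y2 - x2))
                - (y1 - x1) * (a * (z1 - x1) + b * (z2 - x2)) by rewrite /D; ring.
    by rewrite h0 k0 !mulr0 subrr.
  apply/eqP; apply/negPn/negP => D0; apply: ab.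
  move/eqP: aD; move/eqP: bD; rewrite !mulf_eq0 (negbTE D0) !orbF.
  by move=> /eqP -> /eqP ->.
- rewrite -Lx; apply/eqP; rewrite -subr_eq0; apply/eqP; set D := (X in X = 0).
  have D1 : (y1 - x1) * D = 0.
    have -> : (y1 - x1) * D = (z1 - x1) * (a * (y1 - x1) + b * (y2 - x2))
       - b * ((y2 - x2) * (z1 - x1) - (y1 - x1) * (z2 - x2)) by rewrite /D; ring.
    by rewrite h k0 mulr0 subrr mulr0 subrr.
  have D2 : (y2 - x2) * D = 0.
    have -> : (y2 - x2) * D = (z2 - x2) * (a * (y1 - x1) + b * (y2 - x2))
       + a * ((y2 - x2) * (z1 - x1) - (y1 - x1) * (z2 - x2)) by rewrite /D; ring.
    by rewrite h k0 mulr0 subrr mulr0 addr0.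
  apply/eqP; apply/negPn/negP => D0; apply: xy.
  move/eqP: D1; move/eqP: D2; rewrite !mulf_eq0 (negbTE D0) !orbF !subr_eq0.
  by move=> /eqP -> /eqP ->.
Qed.

Lemma finite_monochromatic_lines (R : realType) (S : {fset R * R})
    (c : coloring S) : finite_set (monochromatic_lines c).
Proof.
by apply: sub_finite_set (finite_determined_lines S) => L [].
Qed.

(* [fset_set] is [fset0] on infinite sets; [finite_monochromatic_lines] shows
   that this case does not occur here. *)
Definition num_monochromatic_lines (R : realType) (S : {fset R * R})
    (c : coloring S) : nat := #|` fset_set (monochromatic_lines c)|.

(* Product over the points of S of the Bernoulli(p) law on {blue, red}. *)
Definition coloring_prob (R : realType) (p : R) (S : {fset R * R})
    (c : coloring S) : R := \prod_(x : S) (if c x then p else 1 - p).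

Definition expected_monochromatic_lines (R : realType) (p : R)
    (S : {fset R * R}) : R :=
  \sum_(c : coloring S) coloring_prob p c * (num_monochromatic_lines c)%:R.

(* Main.v *)
Require Import Defs.
From mathcomp Require Import ring lra zify fintype finset.

(* By linearity of expectation, the expected number of monochromatic lines is
   the sum over the determined lines of p^r + (1-p)^r, where r is the number of
   points on the line. Two facts bound this sum from below: the pair count
   sum r(r-1) = n(n-1), and Melchior's inequality sum (3-r) >= 3. A suitable
   nonnegative combination of the two lies below p^r + (1-p)^r for all
   2 <= r <= n-1, with equality only at r = 2 and r = n-1; this is where n >= 10
   is needed, the critical case being r = 3 and p = 1/2.

   Melchior's inequality is Euler's formula for the dual line arrangement,
   phrased with dichotomies of S cut out by a line (the cells of the
   arrangement). Deletion-restriction gives 2 + 2 sum (r-1) dichotomies of S,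
   and 2 d(P) dichotomies of S minus P cut out by a line through P, where d(P)
   is the number of determined lines through P (the edges). Every dichotomy has
   at least three points that can be moved to the other side alone (every
   cell has at least three edges), whence 3 (2 + 2 sum (r-1)) <= 4 sum r. *)

Set Implicit Arguments.
Unset Strict Implicit.
Unset Printing Implicit Defensive.

Local Open Scope ring_scope.

(** * Induction on finite sets and small perturbations *)

Lemma set_ind_U1 (T : finType) (K : {set T} -> Prop) :
  K finset.set0 ->
  (forall x (A : {set T}), x \notin A -> K A -> K (x |: A)%SET) ->
  forall A, K A.
Proof.
move=> K0 KU A; have [m] := ubnP #|A|; elim: m => // m IH in A *.
have [->//|[x xA]] := set_0Vmem A.
rewrite (cardsD1 x) xA => Am; rewrite -(setD1K xA).
by apply: KU; [rewrite !inE eqxx | apply: IH].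
Qed.

(** Finitely many lexicographically positive pairs become positive at a common small [d]. The
    induction proves this for every [e] in the interval up to [d], so that two bounds can be merged
    by their minimum. *)
Lemma small_perturbation (R : realFieldType) (I : eqType) (s : seq I)
    (a b : I -> R) :
  (forall i, i \in s -> 0 < a i \/ a i = 0 /\ 0 < b i) ->
  exists2 d, 0 < d & forall i, i \in s -> 0 < a i + d * b i.
Proof.
move=> ab.
suff [d d0 dP] : exists2 d, 0 < d &
    forall e i, 0 < e <= d -> i \in s -> 0 < a i + e * b i.
  by exists d => // i si; apply: dP => //; rewrite d0 lexx.
elim: s ab => [|j s IH] ab; first by exists 1.
have [i si|d d0 dP] := IH; first by apply: ab; rewrite inE si orbT.
have [d' d'0 d'P] : exists2 d', 0 < d' &
    forall e, 0 < e <= d' -> 0 < a j + e * b j.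
  have [aj|[-> bj]] := ab j (mem_head _ _); last first.
    by exists 1 => // e /andP[e0 _]; rewrite add0r mulr_gt0.
  have b1 : 0 < `|b j| + 1 by rewrite ltr_wpDl.
  exists (a j / (`|b j| + 1)); first by rewrite divr_gt0.
  move=> e /andP[e0]; rewrite ler_pdivlMr // => eb.
  have : - (e * `|b j|) <= e * b j.
    by rewrite -mulrN ler_pM2l // lerNl ler_normr lexx orbT.
  lra.
exists (Order.min d d'); first by rewrite lt_min d0.
move=> e i /andP[e0]; rewrite le_min => /andP[ed ed'].
by rewrite inE => /orP[/eqP ->|si]; [apply: d'P|apply: dP => //]; rewrite e0.
Qed.

(** * Lines as vectors of the dual space *)

Section Plane.
Variable R : realFieldType.

(* The vector (u, v, w) stands for the line u X + v Y = w; those with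
   u = v = 0 stand for the line at infinity. *)
Definition dualv := (R * R * R)%type.

(* Locked to keep ring lemmas from rewriting inside the definition. *)
Definition ev (P : R * R) (x : dualv) : R :=
  locked (P.1 * x.1.1 + P.2 * x.1.2 - x.2).

Definition addv (x : dualv) (t : R) (y : dualv) : dualv :=
  (x.1.1 + t * y.1.1, x.1.2 + t * y.1.2, x.2 + t * y.2).

Lemma evE P x : ev P x = P.1 * x.1.1 + P.2 * x.1.2 - x.2.
Proof. by rewrite /ev -lock. Qed.

Lemma ev_addv P x t y : ev P (addv x t y) = ev P x + t * ev P y.
Proof. rewrite !evE /=; ring. Qed.

(** Up to sign, the cross product of homogeneous coordinates; it is the zero vector when [P = Q]. *)
Definition join (P Q : R * R) : dualv :=
  (P.2 - Q.2, Q.1 - P.1, P.1 * (P.2 - Q.2) + P.2 * (Q.1 - P.1)).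

Lemma ev_joinl P Q : ev P (join P Q) = 0.
Proof. rewrite !evE /=; ring. Qed.

Lemma ev_joinr P Q : ev Q (join P Q) = 0.
Proof. rewrite !evE /=; ring. Qed.

Definition sqdist (P Q : R * R) : R := (Q.1 - P.1) ^+ 2 + (Q.2 - P.2) ^+ 2.

Lemma sqdist_gt0 P Q : P != Q -> 0 < sqdist P Q.
Proof.
move=> PQ; rewrite lt_neqAle addr_ge0 ?sqr_ge0 // andbT eq_sym.
rewrite /sqdist paddr_eq0 ?sqr_ge0 // !sqrf_eq0 !subr_eq0.
by apply: contra PQ; case: P Q => [? ?] [? ?] /= /andP[/eqP -> /eqP ->].
Qed.

(** The factor [c] is the projection of the normal of [x] onto the normal of the line through [P]
    and [Q]. *)
Lemma ev_join_prop P Q x : P != Q -> ev P x = 0 -> ev Q x = 0 ->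
  exists c, forall A, ev A x = c * ev A (join P Q).
Proof.
move=> PQ Px Qx; have d0 := sqdist_gt0 PQ.
exists ((x.1.1 * (P.2 - Q.2) + x.1.2 * (Q.1 - P.1)) / sqdist P Q) => A.
apply: (mulfI (lt0r_neq0 d0)).
rewrite mulrA [X in _ = X * _]mulrC divfK ?lt0r_neq0 //.
move: Px Qx; rewrite !evE /sqdist /= => /eqP; rewrite subr_eq0 => /eqP Px.
rewrite -Px => /eqP; rewrite subr_eq0 => /eqP Qx.
case: P Q x A PQ d0 Px Qx => [a b] [c d] [[u v] w] [e f] /= _ _ _ Qx.
apply/eqP; rewrite -subr_eq0; apply/eqP.
set h := c * u + d * v - (a * u + b * v).
have h0 : h = 0 by rewrite /h Qx subrr.
transitivity (((c - a) * (e - a) + (d - b) * (f - b)) * h); last first.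
  by rewrite h0 mulr0.
rewrite /h; ring.
Qed.

(** The perpendicular at [P] to the line through [P] and [Q]: a vector that vanishes at [P] and is
    positive at [Q] when they differ. *)
Definition perpv (P Q : R * R) : dualv :=
  (Q.1 - P.1, Q.2 - P.2, P.1 * (Q.1 - P.1) + P.2 * (Q.2 - P.2)).

Lemma ev_perpl P Q : ev P (perpv P Q) = 0.
Proof. rewrite !evE /=; ring. Qed.

Lemma ev_perpr P Q : ev Q (perpv P Q) = sqdist P Q.
Proof. rewrite !evE /sqdist /=; ring. Qed.

Lemma ev_join_neq0 P Q : P != Q -> exists A, ev A (join P Q) != 0.
Proof.
move=> PQ; exists (P.1 + (P.2 - Q.2), P.2 + (Q.1 - P.1)).
suff -> : ev (P.1 + (P.2 - Q.2), P.2 + (Q.1 - P.1)) (join P Q) = sqdist P Q.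
  exact/lt0r_neq0/sqdist_gt0.
rewrite !evE /sqdist /=; ring.
Qed.

(** The space is not a finite union of kernels of nonzero functionals: a vector good for the tail is
    moved slightly towards one good for the head. *)
Lemma generic_vector (I : eqType) (s : seq I) (h : I -> dualv -> R) :
  (forall i x t y, h i (addv x t y) = h i x + t * h i y) ->
  (forall i, i \in s -> exists w, h i w != 0) ->
  exists u, forall i, i \in s -> h i u != 0.
Proof.
move=> hD; elim: s => [|j s IH] hs; first by exists (0, 0, 0).
have [i si|u uP] := IH; first by apply: hs; rewrite inE si orbT.
have [w wP] := hs j (mem_head _ _).
have [ju|ju] := eqVneq (h j u) 0; last first.
  by exists u => i; rewrite inE => /orP[/eqP ->|/uP].
(* Where [h i u] is nonzero the quantity kept positive is [h i u * h i (addv u d w)]; where it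
   vanishes, [d * h i w ^+ 2]. *)
have [i|d d0 dP] := @small_perturbation R I (j :: s) (fun i => h i u ^+ 2)
  (fun i => if h i u == 0 then h i w ^+ 2 else h i u * h i w).
  rewrite inE => /orP[/eqP ->|/uP si]; last by left; rewrite exprn_even_gt0.
  by right; rewrite ju eqxx expr0n /= exprn_even_gt0.
exists (addv u d w) => i /dP; rewrite hD; apply: contraTneq => h0.
case: eqP h0 => [-> /eqP|_ h0].
  rewrite add0r mulf_eq0 (negbTE (lt0r_neq0 d0)) /= => /eqP ->.
  by rewrite expr0n mulr0 addr0 ltxx.
by rewrite expr2 mulrCA -mulrDr h0 mulr0 ltxx.
Qed.

End Plane.

Section Melchior.
Variables (R : realFieldType) (T : finType) (pt : T -> R * R).
Hypothesis pt_inj : injective pt.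

Local Notation V := (dualv R).
Local Notation e i := (ev (pt i)).

Definition line (i j : T) : {set T} := [set k | e k (join (pt i) (pt j)) == 0].

Definition lines : {set {set T}} :=
  [set line ij.1 ij.2 | ij in [pred ij : T * T | ij.1 != ij.2]].

Lemma pt_neq i j : i != j -> pt i != pt j.
Proof. by apply: contra => /eqP /pt_inj ->. Qed.

Lemma linel i j : i \in line i j.
Proof. by rewrite inE ev_joinl. Qed.

Lemma liner i j : j \in line i j.
Proof. by rewrite inE ev_joinr. Qed.

Lemma line_in_lines i j : i != j -> line i j \in lines.
Proof. by move=> ij; apply/imsetP; exists (i, j). Qed.

Lemma line_unique L k l : L \in lines -> k \in L -> l \in L -> k != l ->
  L = line k l.
Proof.
case/imsetP => -[i j] /=; rewrite inE /= => ij ->.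
rewrite !inE => /eqP kL /eqP lL kl.
have [c cP] := ev_join_prop (pt_neq kl) kL lL.
have c0 : c != 0.
  have [A] := ev_join_neq0 (pt_neq ij).
  by apply: contraNneq => c0; rewrite cP c0 mul0r.
by apply/setP => m; rewrite !inE cP mulf_eq0 (negbTE c0).
Qed.

Lemma card_lines_ge2 L : L \in lines -> (1 < #|L|)%N.
Proof.
case/imsetP => -[i j] /=; rewrite inE /= => ij ->.
have sub : ([set i; j]%SET \subset line i j).
  apply/subsetP => k.
  by rewrite in_set2 => /orP[]/eqP ->; rewrite ?linel ?liner.
by have := subset_leq_card sub; rewrite cards2 ij.
Qed.

(** * Linearly separable dichotomies *)

Definition sgd (D : {set T}) i : R := if i \in D then 1 else -1.

(** For the whole space the sets [D] index the cells of the dual arrangement; for [ker], those of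
    its restriction to the dual line of a point. Opposite vectors give complementary dichotomies,
    hence the factors 2 in the counts. *)
Definition sep (W : V -> Prop) (A D : {set T}) : Prop :=
  exists2 x, W x & forall i, i \in A -> 0 < sgd D i * e i x.

Definition seps W (A : {set T}) : {set {set T}} :=
  [set D : {set T} | (D \subset A) && `[< sep W A D >]].

Definition subsp (W : V -> Prop) : Prop :=
  forall x t y, W x -> W y -> W (addv x t y).

Definition ker (W : V -> Prop) i : V -> Prop := fun x => W x /\ e i x = 0.

Lemma subsp_ker W i : subsp W -> subsp (ker W i).
Proof.
move=> sW x t y [Wx xi] [Wy yi]; split; first exact: sW.
by rewrite ev_addv xi yi mulr0 addr0.
Qed.

Lemma sgdU1 i j (D : {set T}) : i != j -> sgd (i |: D)%SET j = sgd D j.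
Proof. by move=> ij; rewrite /sgd in_setU1 eq_sym (negbTE ij). Qed.

Lemma sgdD1 i j (D : {set T}) : i != j -> sgd (D :\ i)%SET j = sgd D j.
Proof. by move=> ij; rewrite /sgd in_setD1 eq_sym ij. Qed.

(** Cells are open; the factor [c], later 1 or -1, selects the direction of the move. *)
Lemma sep_perturb (A D : {set T}) x c w :
  (forall i, i \in A -> 0 < sgd D i * e i x) ->
  exists2 d, 0 < d & forall i, i \in A -> 0 < sgd D i * e i (addv x (d * c) w).
Proof.
move=> xP; have [j|d d0 dP] := @small_perturbation R T (enum A)
    (fun j => sgd D j * e j x) (fun j => sgd D j * (c * e j w)).
  by rewrite mem_enum => jA; left; apply: xP.
exists d => // j jA; have := dP j; rewrite mem_enum => /(_ jA).
by rewrite ev_addv mulrDr -(mulrA d) (mulrCA (sgd D j) d).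
Qed.

Lemma sepsU1_split W (A : {set T}) i : i \notin A ->
  #|seps W (i |: A)%SET| =
  (#|seps (fun x => W x /\ (0 < e i x)%R) A| +
   #|seps (fun x => W x /\ (e i x < 0)%R) A|)%N.
Proof.
move=> iA.
have nj j : j \in A -> i != j by move=> jA; apply: contraNneq iA => ->.
rewrite -(cardsID [set D : {set T} | i \in D]); congr (_ + _)%N.
- rewrite -[RHS](card_in_imset (f := fun D => i |: D)%SET); last first.
    move=> D E; rewrite !inE => /andP[DA _] /andP[EA _] DE.
    have iD : i \notin D by apply: contra iA; apply: (subsetP DA).
    have iE : i \notin E by apply: contra iA; apply: (subsetP EA).
    by rewrite -(setU1K iD) DE setU1K.
  apply: eq_card => D; apply/idP/imsetP.
  + rewrite !inE => /andP[/andP[DA /asboolP[x Wx xP]] iD].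
    exists (D :\ i)%SET; last by rewrite setD1K.
    rewrite inE subDset DA /=; apply/asboolP; exists x.
      by split => //; have := xP i (setU11 _ _); rewrite /sgd iD mul1r.
    by move=> j jA; rewrite sgdD1 ?nj //; apply: xP; rewrite in_setU1 jA orbT.
  + case=> E; rewrite !inE => /andP[EA /asboolP[x [Wx x0] xP]] ->.
    rewrite setUS // setU11 andbT /=; apply/asboolP; exists x => // j.
    rewrite in_setU1 => /orP[/eqP ->|jA]; first by rewrite /sgd setU11 mul1r.
    by rewrite sgdU1 ?nj //; apply: xP.
- apply: eq_card => D; rewrite !inE; apply/idP/idP.
  + case/and3P => iD DA /asboolP[x Wx xP].
    have -> : D \subset A.
      apply/subsetP => j jD; have := subsetP DA j jD.
      by rewrite in_setU1 => /orP[/eqP ji|//]; rewrite ji (negbTE iD) in jD.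
    apply/asboolP; exists x.
      split=> //; have := xP i (setU11 _ _).
      by rewrite /sgd (negbTE iD) mulN1r oppr_gt0.
    by move=> j jA; apply: xP; rewrite in_setU1 jA orbT.
  + case/andP => DA /asboolP[x [Wx x0] xP].
    have iD : i \notin D by apply: contra iA; apply: (subsetP DA).
    rewrite iD (subset_trans DA) ?subsetUr //=; apply/asboolP; exists x => // j.
    rewrite in_setU1 => /orP[/eqP ->|]; last exact: xP.
    by rewrite /sgd (negbTE iD) mulN1r oppr_gt0.
Qed.

(* Deletion-restriction: a dichotomy of A extends to i in two ways exactly when
   it is cut out by a line through i. *)
Lemma card_sepsU1 W (A : {set T}) i w :
  subsp W -> i \notin A -> W w -> 0 < e i w ->
  #|seps W (i |: A)%SET| = (#|seps W A| + #|seps (ker W i) A|)%N.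
Proof.
move=> sW iA Ww w0; rewrite sepsU1_split // -cardsUI; congr (_ + _)%N.
all: apply: eq_card => D; rewrite !inE.
- rewrite -andb_orr; congr (_ && _); apply/orP/asboolP.
    by case=> /asboolP[x [Wx _] xP]; exists x.
  case=> x Wx xP; have [x0|x0|x0] := ltgtP (e i x) 0.
  + by right; apply/asboolP; exists x.
  + by left; apply/asboolP; exists x.
  + left; apply/asboolP; have [d d0 dP] := sep_perturb 1 w xP.
    exists (addv x (d * 1) w) => //; split; first exact: sW.
    by rewrite ev_addv x0 add0r mulr1 mulr_gt0.
- rewrite andbACA andbb; congr (_ && _); apply/andP/asboolP.
    case=> /asboolP[x [Wx x0] xP] /asboolP[y [Wy y0] yP].
    (* The segment between witnesses on opposite sides of [i] crosses the kernel at a positive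
       multiple of [addv x c y]. *)
    pose c := e i x / - e i y.
    have c0 : 0 < c by rewrite divr_gt0 // oppr_gt0.
    exists (addv x c y).
      split; first exact: sW.
      rewrite ev_addv /c invrN mulrN mulNr divfK ?subrr //; exact: ltr0_neq0.
    move=> j jA; rewrite ev_addv mulrDr mulrCA addr_gt0 ?xP //.
    by rewrite mulr_gt0 // yP.
  case=> x [Wx x0] xP.
  have [d d0 dP] := sep_perturb 1 w xP.
  have [d' d'0 d'P] := sep_perturb (-1) w xP.
  split; apply/asboolP.
    exists (addv x (d * 1) w) => //; split; first exact: sW.
    by rewrite ev_addv x0 add0r mulr1 mulr_gt0.
  exists (addv x (d' * -1) w) => //; split; first exact: sW.
  by rewrite ev_addv x0 add0r mulrN1 mulNr oppr_lt0 mulr_gt0.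
Qed.

(** * Numbers of dichotomies *)

Definition fullv : V -> Prop := fun _ => True.

Lemma card_seps0 W x : W x -> #|seps W finset.set0| = 1%N.
Proof.
move=> Wx; apply/eqP/cards1P; exists finset.set0; apply/setP => D.
rewrite !inE subset0; case: eqP => //= _.
by apply/asboolP; exists x => // i; rewrite inE.
Qed.

Lemma card_seps_line0 i j k (A : {set T}) :
  i != j -> k \in A -> k \in line i j ->
  #|seps (ker (ker fullv i) j) A| = 0%N.
Proof.
move=> ij kA; rewrite inE => /eqP kL; apply/eqP; rewrite cards_eq0.
apply/eqP/setP => D; rewrite !inE; apply/negbTE; rewrite negb_and; apply/orP.
right; apply/asboolP => -[x [[_ ix] jx] /(_ k kA)].
have [c ->] := ev_join_prop (pt_neq ij) ix jx.
by rewrite kL !mulr0 ltxx.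
Qed.

(** Vectors vanishing at [i] and [j] are multiples of their join, and its two rays induce
    complementary dichotomies. *)
Lemma card_seps_line2 i j (A : {set T}) : i != j -> A != finset.set0 ->
  (forall k, k \in A -> k \notin line i j) ->
  #|seps (ker (ker fullv i) j) A| = 2.
Proof.
move=> ij A0 kL; set v := join (pt i) (pt j).
have ev0 k : k \in A -> e k v != 0 by move/kL; rewrite inE.
have -> : seps (ker (ker fullv i) j) A =
    [set [set k in A | (0 < e k v)%R]; [set k in A | (e k v < 0)%R]]%SET.
  apply/setP => D; rewrite !inE; apply/andP/orP.
    case=> DA /asboolP[x [[_ ix] jx] xP].
    have [c cP] := ev_join_prop (pt_neq ij) ix jx; rewrite -/v in cP.
    have [c0|c0|c0] := ltgtP c 0.
    - right; apply/eqP/setP => k; rewrite inE.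
      have [kA|kA] := boolP (k \in A); last first.
        by apply: contraNF kA; apply: (subsetP DA).
      have := xP k kA; rewrite cP mulrCA nmulr_rgt0 // /sgd.
      case: (k \in D); rewrite ?mul1r ?mulN1r ?oppr_lt0 => h //=.
      by rewrite ltNge ltW.
    - left; apply/eqP/setP => k; rewrite inE.
      have [kA|kA] := boolP (k \in A); last first.
        by apply: contraNF kA; apply: (subsetP DA).
      have := xP k kA; rewrite cP mulrCA pmulr_rgt0 // /sgd.
      case: (k \in D); rewrite ?mul1r ?mulN1r ?oppr_gt0 => h //=.
      by rewrite ltNge ltW.
    - have [k kA] := set0Pn _ A0.
      by have := xP k kA; rewrite cP c0 mul0r mulr0 ltxx.
  have sA (q : pred T) : [set k in A | q k]%SET \subset A.
    by apply/subsetP => k; rewrite inE => /andP[].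
  case=> /eqP ->; (split; first exact: sA); apply/asboolP.
    exists v; first by split; [split|]; rewrite ?ev_joinl ?ev_joinr.
    move=> k kA; rewrite /sgd inE kA /=; have := ev0 k kA.
    by case: (ltgtP (e k v) 0) => // h _; rewrite ?mul1r ?mulN1r ?oppr_gt0.
  (* This is the opposite of [v]. *)
  exists (addv v (-2) v).
    by split; [split|]; rewrite // ev_addv ?ev_joinl ?ev_joinr mulr0 addr0.
  move=> k kA; rewrite /sgd inE kA ev_addv /=; have := ev0 k kA.
  by case: (ltgtP (e k v) 0) => // h _; lra.
rewrite cards2; case: eqP => //= /setP DE.
have [k kA] := set0Pn _ A0; have := DE k; rewrite !inE kA /=.
by have := ev0 k kA; case: (ltgtP (e k v) 0).
Qed.

(** By deletion-restriction, a new point [j] adds 0 dichotomies if the line through [i] and [j]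
    already occurs, and 2 otherwise. *)
Lemma card_seps_ker i (A : {set T}) : i \notin A -> A != finset.set0 ->
  #|seps (ker fullv i) A| = (2 * #|[set line i j | j in A]%SET|)%N.
Proof.
elim/set_ind_U1: A => [|j A jA IH]; first by rewrite eqxx.
rewrite in_setU1 negb_or => /andP[ij iA] _.
have Wx : ker fullv i (perpv (pt i) (pt j)) by split; rewrite // ev_perpl.
rewrite (card_sepsU1 (w := perpv (pt i) (pt j))) //; last 2 first.
- exact: subsp_ker.
- by rewrite ev_perpr sqdist_gt0 // pt_neq.
have [->|A0] := eqVneq A finset.set0.
  rewrite (card_seps0 Wx) setU0 imset_set1 cards1.
  have Wj : ker (ker fullv i) j (join (pt i) (pt j)).
    by split; [split|]; rewrite ?ev_joinl ?ev_joinr.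
  by rewrite (card_seps0 Wj).
rewrite imsetU1 cardsU1 IH // mulnDr addnC; congr (_ + _)%N.
case: imsetP => [[k kA ijk]|nk] /=.
  by rewrite (@card_seps_line0 i j k) // ijk liner.
rewrite card_seps_line2 // => k kA; apply/negP => kij; apply: nk.
exists k => //.
apply: line_unique kij _; [exact: line_in_lines|exact: linel|].
by apply: contraNneq iA => ->.
Qed.

Lemma imset_lineE i (A : {set T}) : i \notin A ->
  [set line i j | j in A]%SET =
  [set L in lines | (i \in L) && (L :&: A != finset.set0)]%SET.
Proof.
move=> iA; apply/setP => L; rewrite inE; apply/imsetP/and3P.
  case=> j jA ->; have ij : i != j by apply: contraNneq iA => ->.
  rewrite line_in_lines // linel; split=> //; apply/set0Pn; exists j.
  by rewrite inE liner.
case=> Ll iL /set0Pn[j]; rewrite inE => /andP[jL jA]; exists j => //.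
by apply: line_unique => //; apply: contraNneq iA => ->.
Qed.

(** A new point [i] raises the sum by one for each line through [i] that already meets [A]. The
    truncated predecessor gives 0 on lines missing [A]. *)
Lemma card_seps_full (A : {set T}) : A != finset.set0 ->
  #|seps fullv A| = (2 + 2 * \sum_(L in lines) #|L :&: A|.-1)%N.
Proof.
elim/set_ind_U1: A => [|i A iA IH]; first by rewrite eqxx.
(* The line at infinity takes the value 1 at every point. *)
move=> _; have w0 : 0 < e i (0, 0, -1) by rewrite evE /= !mulr0 !add0r opprK.
rewrite (card_sepsU1 (w := (0, 0, -1))) //.
have [->|A0] := eqVneq A finset.set0.
  have Wi : ker fullv i (join (pt i) (pt i)) by split; rewrite ?ev_joinl.
  rewrite (@card_seps0 _ (0, 0, 0)) // (card_seps0 Wi) setU0 big1 // => L _.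
  have := subset_leq_card (subsetIr L [set i]%SET).
  by rewrite cards1; case: #|_| => [|[]].
rewrite IH // card_seps_ker // -addnA -mulnDr; congr (2 + 2 * _)%N.
rewrite imset_lineE // -sum1_card.
rewrite [X in (_ + X)%N](eq_bigl (fun L => (L \in lines) &&
  ((i \in L) && (L :&: A != finset.set0)))); last by move=> L; rewrite inE.
rewrite big_mkcondr /= -big_split /=; apply: eq_bigr => L _.
rewrite setIUr cardsU.
have -> : L :&: [set i]%SET :&: (L :&: A) = finset.set0.
  apply/setP => j; rewrite !inE; case: eqP => [->|]; last by rewrite andbF.
  by rewrite (negbTE iA) !andbF.
rewrite cards0 subn0; case: ifP => [/andP[iL LA]|].
  have -> : L :&: [set i]%SET = [set i]%SET.
    by apply/setIidPr; rewrite sub1set.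
  rewrite cards1; move: LA; rewrite -card_gt0.
  by case: #|_| => // m _; rewrite addn1.
move=> h; have [iL|iL] := boolP (i \in L).
  move: h; rewrite iL /= => /negbFE/eqP ->; rewrite cards0 !addn0.
  have := subset_leq_card (subsetIr L [set i]%SET).
  by rewrite cards1; case: #|_| => [|[]].
suff -> : L :&: [set i]%SET = finset.set0 by rewrite cards0 addn0.
apply/setP => j; rewrite !inE.
by case: eqP => [->|]; rewrite ?(negbTE iL) ?andbF.
Qed.

(** * Flippable points and Melchior's inequality *)

Hypothesis noncol : forall i j, i != j -> exists k, k \notin line i j.

(** The dual line of such a point carries an edge of the cell [D]: some vector vanishes at the point
    and keeps all others strictly on their sides. *)
Definition flips (D : {set T}) : {set T} :=
  [set i | `[< sep (ker fullv i) (~: [set i])%SET D >]]%SET.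

(* Walk from the witness x0 in a direction v along which the constraints of the
   flippable points are constant: the first wall that is met belongs to a
   flippable point. A generic u breaks ties. *)
Lemma flips_not_on_line (D : {set T}) i j : i != j ->
  sep fullv finset.setT D -> ~~ (flips D \subset [set i; j]%SET).
Proof.
move=> ij [x0 _ x0P]; apply/negP => /subsetP Fij.
have x0n q : e q x0 != 0.
  by have := x0P q (in_setT _); apply: contraTneq => ->; rewrite mulr0 ltxx.
(* Normalized so that every constraint equals 1 at [x0]; moving from [x0] against [y], the wall of
   largest positive [phi] is met first. *)
pose phi q y := e q y / e q x0.
have phiD q x t y : phi q (addv x t y) = phi q x + t * phi q y.
  by rewrite /phi ev_addv mulrDl mulrA.
have [k] := noncol ij; rewrite inE => kv.
(* [v'] is [v] scaled by [phi k v], which makes [phi k v'] a square and so positive. *)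
pose v := join (pt i) (pt j); pose v' := addv v (phi k v - 1) v.
have phiv q : phi q v' = phi k v * phi q v by rewrite phiD; ring.
have phik : 0 < phi k v'.
  by rewrite phiv -expr2 exprn_even_gt0 //= mulf_neq0 // invr_neq0.
pose h (p : T * T) y := phi p.1 y - phi p.2 y.
have hD p x t y : h p (addv x t y) = h p x + t * h p y.
  by rewrite /h !phiD; ring.
pose s := [seq p <- enum [set: T * T] | p.1 != p.2].
have [p|u uP] := generic_vector (s := s) hD.
  rewrite mem_filter => /andP[pn _]; exists (perpv (pt p.1) (pt p.2)).
  rewrite /h /phi ev_perpl mul0r sub0r oppr_eq0 ev_perpr.
  rewrite mulf_neq0 ?invr_neq0 //.
  exact/lt0r_neq0/sqdist_gt0/pt_neq.
have [q1 _ q1max] := @arg_maxP _ _ _ k xpredT (fun q => phi q v') isT.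
have {}q1max r : phi r v' <= phi q1 v' by exact: q1max.
have [q /eqP qv qmax] := @arg_maxP _ _ _ q1 (fun q => phi q v' == phi q1 v')
  (fun q => phi q u) (eqxx _).
have {}qmax r : phi r v' = phi q v' -> phi r u <= phi q u.
  by move=> rv; apply: qmax; rewrite rv qv.
(* [q] is lexicographically maximal for the values at [v'] and then at [u], hence the strict and
   positive maximum in the direction [addv v' d u]. *)
have [r|d d0 dP] := @small_perturbation R T (enum T)
  (fun r => if r == q then phi q v' else phi q v' - phi r v')
  (fun r => if r == q then phi q u else phi q u - phi r u).
  case: eqP => [_ _|/eqP rq _].
    by left; rewrite qv (lt_le_trans phik) // q1max.
  have := q1max r; rewrite -qv le_eqVlt => /orP[/eqP rv|]; last first.
    by left; rewrite subr_gt0.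
  right; rewrite rv subrr; split=> //; rewrite subr_gt0 lt_neqAle.
  rewrite qmax // andbT.
  have := uP (r, q); rewrite mem_filter /= rq mem_enum in_setT subr_eq0; exact.
pose y := addv v' d u.
have yq : 0 < phi q y.
  by have := dP q; rewrite mem_enum => /(_ isT); rewrite eqxx /y phiD.
have yr r : r != q -> phi r y < phi q y.
  move=> rq; have := dP r; rewrite mem_enum => /(_ isT).
  rewrite (negbTE rq) /y !phiD.
  by rewrite mulrBr; lra.
pose z := addv x0 (- (phi q y)^-1) y.
have zE r : e r z = e r x0 * (1 - phi r y / phi q y).
  rewrite ev_addv; have -> : e r y = e r x0 * phi r y by rewrite mulrC divfK.
  ring.
have /Fij : q \in flips D.
  rewrite inE; apply/asboolP; exists z.
    by split=> //; rewrite zE divff ?subrr ?mulr0 // lt0r_neq0.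
  move=> r; rewrite !inE => rq; rewrite zE mulrA mulr_gt0 ?x0P //.
  by rewrite subr_gt0 ltr_pdivrMr // mul1r yr.
(* But [phi] vanishes on [v] at [i] and [j], so the flippable [q] is neither of them. *)
have : phi q v' != 0 by rewrite qv lt0r_neq0 // (lt_le_trans phik) // q1max.
rewrite phiv mulf_eq0 negb_or => /andP[_].
rewrite !inE => qn /orP[] /eqP qE; move: qn;
  by rewrite qE /phi ?ev_joinl ?ev_joinr mul0r eqxx.
Qed.

(** Two or fewer flippable points would fit in a pair of distinct points. *)
Lemma card_flips (D : {set T}) : (1 < #|T|)%N -> sep fullv finset.setT D ->
  (2 < #|flips D|)%N.
Proof.
move=> T2 sD; rewrite ltnNge; apply/negP => F2.
suff [i [j [ij sub]]] : exists i j, i != j /\ flips D \subset [set i; j]%SET.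
  by move: (flips_not_on_line ij sD); rewrite sub.
have [i0 [j0 ij0]] : exists i j : T, i != j.
  by move: T2 => /card_gt1P[i [j [_ _ ij]]]; exists i, j.
have [/card_gt1P[i [j [iF jF ij]]]|F1] := ltnP 1 #|flips D|.
  exists i, j; split=> //.
  suff /eqP <- : [set i; j]%SET == flips D by [].
  rewrite eqEcard cards2 ij F2 andbT; apply/subsetP => k.
  by rewrite in_set2 => /orP[]/eqP ->.
have [->|[i iF]] := set_0Vmem (flips D).
  by exists i0, j0; rewrite sub0set.
have FE k : k \in flips D -> k = i by move=> kF; apply: (card_le1_eqP F1).
have [ii0|ii0] := eqVneq i i0.
  exists i, j0; rewrite ii0; split=> //; apply/subsetP => k /FE ->.
  by rewrite !inE ii0 eqxx.
by exists i, i0; split=> //; apply/subsetP => k /FE ->; rewrite !inE eqxx.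
Qed.

(** An edge borders at most two cells: a dichotomy of the other points extends only with or without
    [i]. *)
Lemma card_seps_flip_le i :
  (#|[set D in seps fullv finset.setT | i \in flips D]%SET| <=
   2 * #|seps (ker fullv i) (~: [set i])%SET|)%N.
Proof.
rewrite -(cardsID [set D : {set T} | i \in D]%SET) mul2n -addnn leq_add //.
- rewrite -(card_in_imset (f := fun D => D :\ i)%SET); last first.
    move=> D E; rewrite !inE => /andP[_ iD] /andP[_ iE] DE.
    by rewrite -(setD1K iD) DE setD1K.
  apply/subset_leq_card/subsetP => _ /imsetP[D DP ->].
  move: DP; rewrite !inE => /andP[/andP[_ /asboolP[x Wx xP]] iD].
  apply/andP; split; first by apply/subsetP => k; rewrite !inE => /andP[].
  apply/asboolP; exists x => // k kA; rewrite sgdD1 ?xP //.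
  by move: kA; rewrite !inE eq_sym.
- apply/subset_leq_card/subsetP => D; rewrite !inE.
  case/and3P => iD _ ->; rewrite andbT; apply/subsetP => k kD; rewrite !inE.
  by apply: contraNneq iD => <-.
Qed.

Lemma sum_card_lines_mem :
  (\sum_(i : T) #|[set L in lines | i \in L]%SET| = \sum_(L in lines) #|L|)%N.
Proof.
under eq_bigr do rewrite -sum1_card.
under [RHS]eq_bigr do rewrite -sum1_card.
rewrite (exchange_big_dep (mem lines)) //=; last first.
  by move=> i L _; rewrite inE => /andP[].
by apply: eq_bigr => L Ll; apply: eq_bigl => i; rewrite inE Ll.
Qed.

Theorem melchior : (1 < #|T|)%N ->
  (\sum_(L in lines) #|L| + 3 <= 3 * #|lines|)%N.
Proof.
move=> T2.
have T0 : [set: T] != finset.set0 by rewrite -card_gt0 cardsT ltnW.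
have lb : (3 * #|seps fullv [set: T]| <=
    \sum_(D in seps fullv [set: T]) #|flips D|)%N.
  rewrite mulnC -sum_nat_const; apply: leq_sum => D.
  by rewrite inE => /andP[_ /asboolP sD]; apply: card_flips.
(* The 4 is 2 cells per edge times 2 edges per line through a point. *)
have ub : (\sum_(D in seps fullv [set: T]) #|flips D| <=
    4 * \sum_(L in lines) #|L|)%N.
  rewrite -sum_card_lines_mem big_distrr /=.
  under eq_bigr do rewrite -sum1_card.
  rewrite (exchange_big_dep xpredT) //=; apply: leq_sum => i _.
  rewrite sum1dep_card (leq_trans (card_seps_flip_le i)) //.
  have A0 : (~: [set i])%SET != finset.set0.
    by rewrite -card_gt0 cardsC1; case: #|T| T2 => [|[]].
  rewrite card_seps_ker ?inE ?eqxx // mulnA leq_mul2l /=.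
  rewrite imset_lineE ?inE ?eqxx //; apply/subset_leq_card/subsetP => L.
  by rewrite !inE => /and3P[-> ->].
have s1 : (\sum_(L in lines) #|L| =
    \sum_(L in lines) #|L :&: [set: T]|.-1 + #|lines|)%N.
  rewrite -[#|lines|]sum1_card -big_split /=; apply: eq_bigr => L Ll.
  by rewrite finset.setIT addn1 prednK // (leq_trans _ (card_lines_ge2 Ll)).
move: (leq_trans lb ub); rewrite card_seps_full // s1; lia.
Qed.

(** Each ordered pair of distinct points lies on exactly one line. *)
Lemma sum_card_lines_pairs :
  (\sum_(L in lines) #|L| * #|L|.-1 = #|T| * #|T|.-1)%N.
Proof.
transitivity (\sum_(p : T * T | p.1 != p.2) 1)%N; last first.
  rewrite -(pair_big_dep xpredT (fun i j => i != j) (fun _ _ => 1%N)) /=.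
  rewrite -[X in (X * _)%N]sum1_card big_distrl /=; apply: eq_big => // i _.
  rewrite mul1n sum1dep_card -(cardsC1 i).
  by apply: eq_card => j; rewrite !inE eq_sym.
rewrite (partition_big (fun p => line p.1 p.2) (mem lines)) /=; last first.
  by move=> p; apply: line_in_lines.
apply: eq_bigr => L Ll.
rewrite (eq_bigl (fun p => (p.1 \in L) && ((p.2 \in L) && (p.1 != p.2)))).
  rewrite -(pair_big_dep (mem L) (fun i j => (j \in L) && (i != j))
    (fun _ _ => 1%N)) /=.
  rewrite -{1}sum1_card big_distrl /=; apply: eq_bigr => i iL.
  rewrite mul1n sum1dep_card (cardsD1 i L) iL /=.
  by apply: eq_card => j; rewrite !inE andbC eq_sym.
move=> [i j] /=; have [->|ij] := eqVneq i j; first by rewrite !andbF.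
rewrite andbT; apply/eqP/andP => [<-|[iL jL]]; first by rewrite linel liner.
by rewrite -(line_unique Ll).
Qed.
End Melchior.

(** * The linear programming bound *)

Section Bound.
Variables (R : realFieldType) (p : R).
Hypothesis p01 : 0 <= p <= 1.

(** For positive [r], the probability that [r] given points share a color. *)
Definition mono (r : nat) : R := p ^+ r + (1 - p) ^+ r.

Lemma mono_gt0 r : 0 < mono r.
Proof.
have /andP[p0 p1] := p01.
rewrite /mono; have [->|p0'] := eqVneq p 0.
  by rewrite subr0 expr1n ltr_wpDl // exprn_ge0.
by rewrite ltr_pwDl ?exprn_gt0 ?exprn_ge0 ?subr_ge0 // lt_neqAle eq_sym p0'.
Qed.

Lemma mono_decr r s : (r <= s)%N -> mono s <= mono r.
Proof.
have /andP[p0 p1] := p01 => rs.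
by rewrite lerD // ler_wiXn2l // ?subr_ge0 // gerBl.
Qed.

(* [a] and [b] are the dual multipliers of Melchior's inequality and of the
   pair count; the constraint is tight at the line sizes 2 and [m] of a
   near-pencil on [m + 1] points. *)
Lemma mono_certificate (m : nat) : (9 <= m)%N ->
  exists a b, [/\ 0 < a, mono 2 = a + b,
    mono m = a * (3 - m%:R) + b * (m%:R * (m%:R - 1) / 2) &
    forall r : nat, (3 <= r < m)%N ->
      a * (3 - r%:R) + b * (r%:R * (r%:R - 1) / 2) < mono r].
Proof.
move=> m9; set y : R := m%:R.
have y9 : 9 <= y by rewrite /y ler_nat.
have D0 : 0 < (y + 3) * (y - 2) by rewrite mulr_gt0 //; lra.
(* Solution of the two equations expressing tightness at 2 and [m]. *)
pose b := 2 * (mono m + (y - 3) * mono 2) / ((y + 3) * (y - 2)).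
have bD : b * ((y + 3) * (y - 2)) = 2 * (mono m + (y - 3) * mono 2).
  by rewrite divfK // lt0r_neq0.
have f20 := mono_gt0 2; have fm0 := mono_gt0 m.
have fm2 : mono m <= mono 2 by apply: mono_decr; lia.
exists (mono 2 - b), b; split.
- rewrite subr_gt0 /b ltr_pdivrMr //.
  have : 0 < mono 2 * ((y - 2) * (y + 1)) by rewrite !mulr_gt0 //; lra.
  lra.
- by rewrite subrK.
- by lra.
move=> r /andP[r3 rm]; set x : R := r%:R.
have fr0 := mono_gt0 r.
have fmr : mono m <= mono r by apply: mono_decr; exact: ltnW.
have xy : x + 1 <= y by rewrite /x /y natr1 ler_nat.
have x3 : 3 <= x by rewrite /x ler_nat.
(* Cleared of denominators, the slack is [y - x] times the gap in [key], plus a nonnegative multiple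
   of [mono r - mono m]. *)
suff key : (mono 2 - mono r) * (x + y + 1) < mono 2 * ((x - 2) * (y - 2)).
  rewrite -subr_gt0 -(pmulr_rgt0 _ D0).
  have -> : (y + 3) * (y - 2) *
      (mono r - ((mono 2 - b) * (3 - x) + b * (x * (x - 1) / 2))) =
    (y + 3) * (y - 2) * (mono r + (x - 3) * mono 2)
      - b * ((y + 3) * (y - 2)) * ((x + 3) * (x - 2) / 2) by field.
  rewrite bD.
  have -> : (y + 3) * (y - 2) * (mono r + (x - 3) * mono 2)
      - 2 * (mono m + (y - 3) * mono 2) * ((x + 3) * (x - 2) / 2) =
    (y - x) * (mono 2 * ((x - 2) * (y - 2)) - (mono 2 - mono r) * (x + y + 1))
      + (mono r - mono m) * ((x + 3) * (x - 2)) by field.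
  rewrite ltr_pwDl ?mulr_gt0 ?mulr_ge0 //; lra.
(* From 4 on, bounding [mono 2 - mono r] by [mono 2] suffices; [K] is an equality at [x = 4],
   [y = 9]. *)
have [r4|r4] := leqP 4 r.
  have x4 : 4 <= x by rewrite /x ler_nat.
  have K : x + y + 1 <= (x - 2) * (y - 2) by nra.
  apply: (@lt_le_trans _ _ (mono 2 * (x + y + 1))); last by rewrite ler_pM2l.
  rewrite ltr_pM2r; lra.
have r3E : r = 3%N by apply/eqP; rewrite eqn_leq -ltnS r4.
have -> : x = 3 by rewrite /x r3E.
have -> : mono 2 - mono r = p * (1 - p) by rewrite r3E /mono; ring.
have -> : mono 2 = 1 - 2 * (p * (1 - p)) by rewrite /mono; ring.
(* For [r = 3] the claim reads [3 * y * (p * (1 - p)) < y - 2]; at the maximum 1/4 this says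
   [y > 8]. *)
have q4 : p * (1 - p) <= 1 / 4 by have := sqr_ge0 (2 * p - 1); lra.
nra.
Qed.

(** * Sums of [mono] over the determined lines *)

Variables (T : finType) (pt : T -> R * R).
Hypothesis pt_inj : injective pt.
Hypothesis noncol : forall i j, i != j -> exists k, k \notin line pt i j.

Lemma card_lines_lt L : L \in lines pt -> (#|L| < #|T|)%N.
Proof.
case/imsetP => -[i j] /= ij ->; have [k kL] := noncol ij.
by rewrite -cardsT; apply: proper_card; apply/properP; split=> //; exists k.
Qed.

Lemma melchiorR : (1 < #|T|)%N -> 3 <= \sum_(L in lines pt) (3 - #|L|%:R : R).
Proof.
move=> T2; have := melchior pt_inj noncol T2; rewrite -(ler_nat R).
rewrite natrD natrM big_split /= sumr_const sumrN -natr_sum -mulr_natl; lra.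
Qed.

Lemma sum_pairsR : \sum_(L in lines pt) (#|L|%:R * (#|L|%:R - 1) / 2) =
  #|T|%:R * (#|T|%:R - 1) / 2 :> R.
Proof.
have E (k : nat) : k%:R * (k%:R - 1) = (k * k.-1)%:R :> R.
  by case: k => [|k]; rewrite ?mul0r // natrM -natr1 addrK.
under eq_bigr do rewrite E.
by rewrite -mulr_suml -natr_sum sum_card_lines_pairs // E.
Qed.

Let m := #|T|.-1.
Hypothesis T10 : (10 <= #|T|)%N.

Let m9 : (9 <= m)%N. Proof. by rewrite /m; lia. Qed.
Let TE : #|T|%:R = m%:R + 1 :> R.
Proof. by rewrite natr1 /m prednK //; lia. Qed.

(** A near-pencil has [m] lines of size 2 and one of size [m], for which Melchior's inequality is
    tight. *)
Lemma certificate_value a b : mono 2 = a + b ->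
  mono m = a * (3 - m%:R) + b * (m%:R * (m%:R - 1) / 2) ->
  m%:R * mono 2 + mono m = a * 3 + b * (#|T|%:R * (#|T|%:R - 1) / 2).
Proof. by move=> -> ->; rewrite TE; field. Qed.

(** Weak duality: [a] times Melchior's inequality plus [b] times the pair count. *)
Lemma sum_mono_ge :
  m%:R * mono 2 + mono m <= \sum_(L in lines pt) mono #|L|.
Proof.
have [a [b [a0 E2 Em H]]] := mono_certificate m9.
rewrite (certificate_value E2 Em) -sum_pairsR.
apply: (@le_trans _ _ (\sum_(L in lines pt)
    (a * (3 - #|L|%:R) + b * (#|L|%:R * (#|L|%:R - 1) / 2)))).
  by rewrite big_split /= -!mulr_sumr lerD2r ler_pM2l // melchiorR //; lia.
apply: ler_sum => L Ll.
have := card_lines_ge2 Ll; rewrite leq_eqVlt => /orP[/eqP <-|L3].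
  by rewrite E2; lra.
have := card_lines_lt Ll; rewrite -[#|T|]prednK ?ltnS; last by lia.
rewrite -/m leq_eqVlt => /orP[/eqP ->|Lm]; first by rewrite -Em.
by apply/ltW/H; rewrite L3.
Qed.

Lemma sum_mono_gt : (forall L, L \in lines pt -> #|L| <> m) ->
  m%:R * mono 2 + mono m < \sum_(L in lines pt) mono #|L|.
Proof.
move=> Lneq.
have Lm L : L \in lines pt -> (#|L| < m)%N.
  by move=> Ll; have := card_lines_lt Ll; have := Lneq L Ll; rewrite /m; lia.
have [a [b [a0 E2 Em H]]] := mono_certificate m9.
rewrite (certificate_value E2 Em) -sum_pairsR.
have Lle L : L \in lines pt ->
    a * (3 - #|L|%:R) + b * (#|L|%:R * (#|L|%:R - 1) / 2) <= mono #|L|.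
  move=> Ll; have := card_lines_ge2 Ll; rewrite leq_eqVlt => /orP[/eqP <-|L3].
    by rewrite E2; lra.
  by apply/ltW/H; rewrite L3 Lm.
have T2 : (1 < #|T|)%N by lia.
(* A line with at least three points gives strictness in its own term. If all lines are pairs,
   Melchior's inequality is strict, its left side being the number of all pairs. *)
have [/existsP[L /andP[Ll L3]]|] := boolP [exists L in lines pt, (2 < #|L|)%N].
  apply: (@le_lt_trans _ _ (\sum_(L in lines pt)
      (a * (3 - #|L|%:R) + b * (#|L|%:R * (#|L|%:R - 1) / 2)))).
    by rewrite big_split /= -!mulr_sumr lerD2r ler_pM2l // melchiorR.
  rewrite (bigD1 L) //= [ltRHS](bigD1 L) //= ltr_leD //.
    by apply: H; rewrite L3 Lm.
  by apply: ler_sum => K /andP[Kl _]; apply: Lle.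
rewrite negb_exists => /forallP L2.
have {}L2 L : L \in lines pt -> #|L| = 2.
  move=> Ll; have := L2 L; rewrite Ll /= -leqNgt => h.
  by apply/eqP; rewrite eqn_leq h (card_lines_ge2 Ll).
have : \sum_(L in lines pt) (#|L|%:R * (#|L|%:R - 1) / 2) =
    \sum_(L in lines pt) (1 : R).
  by apply: eq_bigr => L /L2 ->; field.
have -> : \sum_(L in lines pt) mono #|L| =
    mono 2 * \sum_(L in lines pt) (1 : R).
  by rewrite mulr_sumr; apply: eq_bigr => L /L2 ->; rewrite mulr1.
rewrite sum_pairsR => <-; rewrite E2 mulrDl ltrD2r ltr_pM2l //.
have ym : (9 : R) <= m%:R by rewrite ler_nat.
by rewrite TE; nra.
Qed.

(** Any other line meets [L0] at most once, so it joins a point of [L0] to the single point [q] off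
    it; there are at most [m] such lines. *)
Lemma sum_mono_near_pencil L0 : L0 \in lines pt -> #|L0| = m ->
  \sum_(L in lines pt) mono #|L| <= m%:R * mono 2 + mono m.
Proof.
move=> L0l L0m.
have /cards1P[q qE] : #|(~: L0)%SET| == 1%N.
  by have := cardsC L0; rewrite L0m /m => h; apply/eqP; lia.
have qL0 : q \notin L0 by rewrite -in_setC qE set11.
rewrite (bigD1 L0) //= L0m addrC lerD2r.
have sub : [set L in lines pt | L != L0]%SET \subset
    [set [set i; q] | i in L0]%SET.
  apply/subsetP => L; rewrite inE => /andP[Ll LL0].
  have one i j : i \in L -> j \in L -> i \in L0 -> j \in L0 -> i = j.
    move=> iL jL iL0 jL0; apply/eqP; apply: contraNT LL0 => ij.
    rewrite (line_unique pt_inj Ll iL jL ij).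
    by rewrite (line_unique pt_inj L0l iL0 jL0 ij).
  have LE i : i \in L -> i \in L0 \/ i = q.
    move=> iL; have [|iL0] := boolP (i \in L0); [by left|right].
    by apply/set1P; rewrite -qE inE.
  have /card_gt1P[i [j [iL jL ij]]] := card_lines_ge2 Ll.
  have [k [kL kL0 qL]] : exists k, [/\ k \in L, k \in L0 & q \in L].
    case: (LE i iL) => [iL0|iq]; case: (LE j jL) => [jL0|jq].
    - by rewrite (one i j) ?eqxx in ij.
    - by exists i; rewrite -jq.
    - by exists j; rewrite -iq.
    - by rewrite iq jq eqxx in ij.
  apply/imsetP; exists k => //; apply/setP => l; rewrite !inE; apply/idP/orP.
    by move=> lL; case: (LE l lL) => [lL0|->]; [left; rewrite (one l k)|right].
  by case=> /eqP ->.
rewrite (eq_bigr (fun=> mono 2)); last first.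
  move=> L LP; have : L \in [set L in lines pt | L != L0]%SET by rewrite inE.
  move/(subsetP sub)/imsetP => [i iL0 ->]; rewrite cards2.
  by case: eqP => [iq|//]; rewrite iq (negbTE qL0) in iL0.
rewrite sumr_const -[leLHS]mulr_natl ler_pM2r ?mono_gt0 // ler_nat.
rewrite -L0m (leq_trans _ (leq_imset_card (fun i => [set i; q]%SET) _)) //.
have := subset_leq_card sub; congr (_ <= _)%N.
by apply: eq_card => L; rewrite !inE.
Qed.

End Bound.

(** * Expected number of monochromatic lines *)

Section Colorings.
Variables (R : realType) (p : R) (S : {fset R * R}).

Lemma sum_coloring_prob_const (L : {set S}) (b : bool) :
  \sum_(c : coloring S) coloring_prob p c * [forall x in L, c x == b]%:R =
  (if b then p else 1 - p) ^+ #|L|.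
Proof.
pose F (x : S) (d : bool) : R :=
  (if d then p else 1 - p) * ((x \in L) ==> (d == b))%:R.
transitivity (\sum_(c : {ffun S -> bool}) \prod_(x : S) F x (c x)).
  apply: eq_bigr => c _; rewrite /F big_split /=; congr (_ * _).
  have [/forall_inP cL|] := boolP [forall x in L, c x == b].
    by rewrite big1 // => x _; case: (boolP (x \in L)) => //= /cL ->.
  rewrite negb_forall_in => /exists_inP[x xL cx].
  by rewrite (bigD1 x) //= xL (negbTE cx) mul0r.
(* Independence: the sum over colorings factors over points, and a point off [L] contributes
   [p + (1 - p) = 1]. *)
rewrite -bigA_distr_bigA /= -prodr_const [RHS]big_mkcond /=.
apply: eq_bigr => x _; rewrite big_bool /F /=; case: (x \in L) => /=.
  by case: {F} b; rewrite /= !(mulr0, mulr1, addr0, add0r).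
by rewrite !mulr1 addrC subrK.
Qed.

(** A point of [L] makes the all-blue and all-red events disjoint. *)
Lemma sum_coloring_prob_mono (L : {set S}) : L != finset.set0 ->
  \sum_(c : coloring S) coloring_prob p c *
    [forall x in L, forall y in L, c x == c y]%:R = mono p #|L|.
Proof.
move=> /set0Pn[z zL].
rewrite /mono -(sum_coloring_prob_const L true).
rewrite -(sum_coloring_prob_const L false) -big_split /=.
apply: eq_bigr => c _; rewrite -mulrDr -natrD; congr (_ * _%:R).
have E : [forall x in L, forall y in L, c x == c y] =
    [forall x in L, c x == c z].
  apply/forall_inP/forall_inP => [h x /h/forall_inP|h x xL]; first exact.
  by apply/forall_inP => y yL; rewrite (eqP (h x xL)) eq_sym h.
have zN : [forall x in L, c x == ~~ c z] = false.
  by apply/forall_inP => /(_ z zL); case: (c z).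
by rewrite E; case: (c z) zN => /= ->; rewrite ?addn0.
Qed.

(** * Lines of the plane and their traces on the point set *)

Definition trace (L : set (R * R)) : {set S} := [set x : S | `[< L (val x) >]].

Lemma is_lineP (L : set (R * R)) : is_line L ->
  exists2 x : dualv R, (exists A, ev A x != 0) &
    L = [set z | ev z x = 0]%classic.
Proof.
move=> [a [b [c [ab ->]]]]; exists (a, b, c).
  have [a0|a0] := eqVneq a 0.
    have b0 : b != 0 by apply: contra_not_neq ab => b0; rewrite a0 b0.
    exists (0, (c + 1) / b); rewrite evE /= mul0r add0r divfK //.
    by rewrite addrAC subrr add0r oner_neq0.
  exists ((c + 1) / a, 0); rewrite evE /= mul0r addr0 divfK //.
  by rewrite addrAC subrr add0r oner_neq0.
apply/seteqP; split=> z /=; rewrite evE /= (mulrC z.1) (mulrC z.2) => h.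
  by rewrite h subrr.
by apply/eqP; rewrite -subr_eq0 h.
Qed.

Lemma is_line_join (P Q : R * R) : P != Q ->
  is_line [set z | ev z (join P Q) = 0]%classic.
Proof.
move=> PQ; exists (join P Q).1.1, (join P Q).1.2, (join P Q).2.
split.
  case=> /eqP h1 /eqP h2; move: h1 h2; rewrite !subr_eq0 => h1 h2.
  by move: PQ; rewrite -pair_eqE /pair_eq /= eq_sym h2 h1.
apply/seteqP; split=> z /=; rewrite evE /= (mulrC z.1) (mulrC z.2) => h.
  by apply/eqP; rewrite -subr_eq0 h.
by rewrite h subrr.
Qed.

Lemma is_line_unique (L : set (R * R)) (P Q : R * R) :
  is_line L -> P != Q -> L P -> L Q ->
  L = [set z | ev z (join P Q) = 0]%classic.
Proof.
move=> /is_lineP[x [A Ax] ->] PQ /= Px Qx.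
have [c cP] := ev_join_prop PQ Px Qx.
have c0 : c != 0 by apply: contraNneq Ax => c0; rewrite cP c0 mul0r.
apply/seteqP; split=> z /=; rewrite cP => /eqP.
  by rewrite mulf_eq0 (negbTE c0) => /eqP.
by move=> /eqP ->; rewrite mulr0.
Qed.

Local Notation pt := (val : S -> R * R).

Lemma trace_join (i j : S) :
  trace [set z | ev z (join (pt i) (pt j)) = 0]%classic = line pt i j.
Proof. by apply/setP => k; rewrite !inE; apply/asboolP/eqP. Qed.

Lemma trace_line (L : set (R * R)) (i j : S) : is_line L -> i != j ->
  i \in trace L -> j \in trace L -> trace L = line pt i j.
Proof.
move=> Ll ij; rewrite !inE => /asboolP iL /asboolP jL.
by rewrite (is_line_unique Ll _ iL jL) ?trace_join.
Qed.

Lemma trace_lines (L : set (R * R)) : is_line L -> (1 < #|trace L|)%N ->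
  trace L \in lines pt.
Proof.
move=> Ll /card_gt1P[i [j [iL jL ij]]].
by rewrite (trace_line Ll ij) ?line_in_lines.
Qed.

Lemma determined_trace (L : set (R * R)) : determined_line S L ->
  is_line L /\ (1 < #|trace L|)%N.
Proof.
move=> [Ll [x [y [xS yS xy Lx Ly]]]]; split=> //.
apply/card_gt1P; exists [` xS]%fset, [` yS]%fset; split; rewrite ?inE.
- exact/asboolP.
- exact/asboolP.
- by apply/eqP => /(congr1 val).
Qed.

(** [trace] is a bijection from determined lines to [lines pt] that preserves monochromaticity: two
    points of the trace recover the line. *)
Lemma num_monochromatic_linesE (c : coloring S) :
  num_monochromatic_lines c =
  (\sum_(L in lines pt) [forall x in L, forall y in L, c x == c y])%N.
Proof.
pose q (L : {set S}) := [forall x in L, forall y in L, c x == c y].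
have -> : (\sum_(L in lines pt) q L = \sum_(L in lines pt | q L) 1)%N.
  by rewrite big_mkcondr; apply: eq_bigr => L _; case: (q L).
rewrite sum1dep_card cardE /num_monochromatic_lines.
rewrite -(size_map trace); apply: perm_size; apply: uniq_perm.
- rewrite map_inj_in_uniq ?fset_uniq // => L K.
  rewrite !in_fset_set; try exact: finite_monochromatic_lines.
  rewrite !classical_sets.in_setE => -[dL _] [dK _] LK.
  have [Ll /card_gt1P[i [j [iL jL ij]]]] := determined_trace dL.
  have [Kl _] := determined_trace dK.
  have pij : pt i != pt j by [].
  move: (iL) (jL) => iK jK; rewrite LK in iK jK.
  move: iL jL iK jK; rewrite !inE.
  move=> /asboolP iL /asboolP jL /asboolP iK /asboolP jK.
  by rewrite (is_line_unique Ll pij iL jL) (is_line_unique Kl pij iK jK).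
- exact: enum_uniq.
move=> A; rewrite mem_enum inE; apply/mapP/andP.
  case=> L; rewrite in_fset_set; last exact: finite_monochromatic_lines.
  rewrite classical_sets.in_setE => -[dL mL] ->.
  have [Ll L2] := determined_trace dL.
  split; first exact: trace_lines.
  apply/forall_inP => x; rewrite inE => /asboolP xL.
  by apply/forall_inP => y; rewrite inE => /asboolP yL; rewrite (mL x y).
case=> /imsetP[[i j] /= ij ->] /forall_inP cA.
exists [set z | ev z (join (pt i) (pt j)) = 0]%classic; last first.
  by rewrite trace_join.
rewrite in_fset_set; last exact: finite_monochromatic_lines.
rewrite classical_sets.in_setE; split.
  split; first exact: is_line_join.
  exists (pt i), (pt j); split=> //=; rewrite ?ev_joinl ?ev_joinr //.
  by move/val_inj/eqP; apply/negP.
move=> x y /= xL yL; have xA : x \in line pt i j by rewrite inE; apply/eqP.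
have yA : y \in line pt i j by rewrite inE; apply/eqP.
exact/eqP/(forall_inP (cA x xA)).
Qed.

Lemma expected_monochromatic_linesE :
  expected_monochromatic_lines p S = \sum_(L in lines pt) mono p #|L|.
Proof.
rewrite /expected_monochromatic_lines.
under eq_bigr do rewrite num_monochromatic_linesE natr_sum mulr_sumr.
rewrite exchange_big /=; apply: eq_bigr => L Ll.
by rewrite sum_coloring_prob_mono // -card_gt0 ltnW // (card_lines_ge2 Ll).
Qed.

Lemma card_trace (L : set (R * R)) :
  #|` [fset x in S | x \in L]%fset| = #|trace L|.
Proof.
rewrite [RHS]cardE -(size_map val); apply: perm_size; apply: uniq_perm.
- exact: fset_uniq.
- by rewrite map_inj_uniq ?enum_uniq //; exact: val_inj.
move=> x; apply/idP/mapP => [|[y]].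
  rewrite !finmap.inE /= => /andP[xS /[!classical_sets.in_setE] xL].
  exists [` xS]%fset => //.
  by rewrite mem_enum inE; apply/asboolP.
rewrite mem_enum inE => /asboolP yL ->; rewrite !finmap.inE /= (fsvalP y) /=.
by rewrite classical_sets.in_setE.
Qed.

(** * Collinearity and near-pencils in terms of traces *)

Lemma collinear_trace : collinear S <->
  exists L, is_line L /\ trace L = [set: S].
Proof.
split=> -[L [Ll LS]]; exists L; split=> //.
  by apply/setP => x; rewrite !inE; apply/asboolP/LS; exact: fsvalP.
move=> x /= xS; have : [` xS]%fset \in trace L by rewrite LS inE.
by rewrite inE => /asboolP.
Qed.

Lemma noncollinear_line : ~ collinear S ->
  forall i j : S, i != j -> exists k, k \notin line pt i j.
Proof.
move=> nS i j ij; have [k kL|h] := pickP (fun k => k \notin line pt i j).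
  by exists k.
case: nS; apply/collinear_trace.
exists [set z | ev z (join (pt i) (pt j)) = 0]%classic.
split; first exact: is_line_join.
by rewrite trace_join; apply/setP => k; have /negbFE := h k; rewrite !inE => ->.
Qed.

(** With at least three points, a line through all but one contains two of them and is thus
    determined. *)
Lemma near_pencilP : (3 <= #|{: S}|)%N ->
  near_pencil S <-> exists2 L, L \in lines pt & #|L| = #|{: S}|.-1.
Proof.
move=> S3; split=> [[L [Ll]]|[_ /imsetP[[i j] /= ij ->] Lm]].
  rewrite card_trace cardfE subn1 => Lm; exists (trace L) => //.
  by apply: trace_lines => //; rewrite Lm; lia.
exists [set z | ev z (join (pt i) (pt j)) = 0]%classic; split.
  exact: is_line_join.
by rewrite card_trace trace_join Lm cardfE subn1.
Qed.

Lemma near_pencil_noncollinear : (3 <= #|{: S}|)%N -> near_pencil S ->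
  ~ collinear S.
Proof.
move=> S3 /(near_pencilP S3)[L Ll Lm] /collinear_trace[K [Kl KS]].
have /card_gt1P[i [j [iL jL ij]]] := card_lines_ge2 Ll.
have := trace_line Kl ij; rewrite KS !inE => /(_ isT isT) SE.
move: Lm; rewrite (line_unique val_inj Ll iL jL ij) -SE cardsT => SS.
have : #|{: S}| = #|{: S}|.-1 := SS; lia.
Qed.

End Colorings.

(** The weak inequality, applied both ways, shows that all near-pencils on [n] points share the same
    expectation. *)
Theorem theorem3p1 (R : realType) (p : R) (n : nat)
    (hp : 0 <= p <= 1) (hn : (10 <= n)%N)
    (N : {fset R * R}) (cardN : #|` N| = n) (pencilN : near_pencil N) :
  ~ collinear N /\
  forall S : {fset R * R}, #|` S| = n -> ~ collinear S ->
    expected_monochromatic_lines p N <= expected_monochromatic_lines p S /\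
    (~ near_pencil S ->
     expected_monochromatic_lines p N < expected_monochromatic_lines p S).
Proof.
rewrite cardfE in cardN; have N3 : (3 <= #|{: N}|)%N by lia.
split; first exact: near_pencil_noncollinear.
move=> S; rewrite cardfE => cardS nS.
have S3 : (3 <= #|{: S}|)%N by lia.
have noncolS := noncollinear_line nS.
have T10 : (10 <= #|{: S}|)%N by rewrite cardS.
have [L0 L0l L0m] := (near_pencilP N3).1 pencilN.
have := sum_mono_near_pencil hp val_inj _ L0l L0m.
rewrite !expected_monochromatic_linesE cardN -cardS => /(_ T10) leN.
split; first exact: le_trans leN (sum_mono_ge hp val_inj noncolS T10).
move=> nNP; apply: le_lt_trans leN (sum_mono_gt hp val_inj noncolS T10 _).
by move=> L Ll LE; apply: nNP; apply/(near_pencilP S3); exists L.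
Qed.
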